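(* Suppose $H=(V,E)$ is a hypergraph on $n$ vertices with maximum degree $\Delta$. Then triangle and simplex enumeration can be performed in $O(\Delta)$ rounds of the EDGE BROADCAST (EB) and PRIMAL CONGEST (PC) models.
   Context: A hypergraph $H=(V,E)$ has vertex set $V$, $|V|=n$, and a set $E$ of nonempty subsets of $V$; $\deg(v)$ is the number of edges containing $v$, $\Delta=\max_v\deg(v)$, and the rank $r$ is the maximum cardinality of an edge. A triangle is a simple cycle of length three $(v_0,e_0,v_1,e_1,v_2,e_2)$: distinct vertices, distinct edges, $v_i\in e_{i-1}\cap e_i$ (indices mod $3$); it is induced if moreover $v_i\notin e_{i+1}$ for each $i$. An ($r$-dimensional) simplex is a set of $r+1$ vertices all of whose $r$-element subsets are edges. In the triangle (simplex) enumeration problem each vertex outputs a set of triangles (simplices) such that these sets are pairwise disjoint and their union is the set of all triangles (simplices) of $H$; the triangle result applies both to all triangles and to all induced triangles. Computation: vertices are nodes with unique $O(\log n)$-bit IDs; synchronous rounds with unbounded local computation; $B=\Theta(\log n)$; initially each vertex knows its ID and its incident edges, including the IDs of the vertices in them ($\mathrm{KT}_1$), with a port numbering. In EB, in each round, for each vertex $v$ and each edge $e\ni v$, $v$ can broadcast one $B$-bit message to all vertices of $e$ (possibly different messages on different edges). In PC, in each round each vertex $v$ can send a distinct $B$-bit message to each vertex sharing an edge with $v$ (one per such vertex).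
   Formalization: Simplex enumeration is claimed only for rank r ≠ 1 (for r = 1 it is false: vertices in singleton edges cannot communicate) and with r known to all vertices (else impossible); vertices know n; triangles are output with vertex IDs and consistent, distinct edge names rather than vertex sets. *)

(* Defs.v *)
(* Distributed enumeration of triangles and simplices in hypergraphs
   (Mathematical Components). *)
From mathcomp Require Import all_boot all_algebra.

Set Implicit Arguments.
Unset Strict Implicit.
Unset Printing Implicit Defensive.

Import GRing.Theory.

Record hypergraph (V : finType) := Hypergraph {
  edges :> {set {set V}};
  edges_nonempty : set0 \notin edges }.

Section Hypergraphs.

Variables (V : finType) (H : hypergraph V).

Definition incident (v : V) : {set {set V}} := [set e in edges H | v \in e].

Definition deg (v : V) : nat := #|incident v|.

Definition maxdeg : nat := \max_(v : V) deg v.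

Definition rank : nat := \max_(e in edges H) #|e|.

(* The cyclic sequence (v_0, e_0, v_1, e_1, v_2, e_2); t i is the pair
   (v_i, e_i) and index arithmetic in 'I_3 is modulo 3. *)
Definition cyc3 : predArgType := {ffun 'I_3 -> V * {set V}}.

Definition triangle (t : cyc3) : bool :=
  [&& injectiveb (fun i => (t i).1),
      injectiveb (fun i => (t i).2),
      [forall i, (t i).2 \in edges H]
    & [forall i, (t i).1 \in (t (i - 1)%R).2 :&: (t i).2]].

Definition induced_triangle (t : cyc3) : bool :=
  triangle t && [forall i, (t i).1 \notin (t (i + 1)%R).2].

Definition rot3 (k : 'I_3) (t : cyc3) : cyc3 := [ffun i => t (i + k)%R].

(* The same cycle traversed backwards: (v_0, e_2, v_2, e_1, v_1, e_0). *)
Definition rev3 (t : cyc3) : cyc3 :=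
  [ffun i => ((t (- i)%R).1, (t (- i - 1)%R).2)].

Definition same_cycle (t t' : cyc3) : bool :=
  [exists k, (t' == rot3 k t) || (t' == rot3 k (rev3 t))].

Definition simplex (S : {set V}) : bool :=
  (#|S| == rank.+1)
  && [forall f : {set V}, (f \subset S) && (#|f| == rank) ==> (f \in edges H)].

End Hypergraphs.

(* ports v lists the edges at v in the order of v's port numbers 0, 1, ... *)
Record network (V : finType) := Network {
  hyp : hypergraph V;
  id : V -> nat;
  ports : V -> seq {set V};
  id_inj : injective id;
  portsP : forall v, perm_eq (ports v) (enum (incident hyp v)) }.

Definition short_ids (c : nat) (V : finType) (N : network V) : Prop :=
  forall v, id N v < #|V| ^ c.

(* B = Theta(log n) *)
Definition theta_log (B : nat -> nat) : Prop :=
  exists a b : nat, forall n, 1 < n ->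
    (trunc_log 2 n <= a * B n) && (B n <= b * trunc_log 2 n).

(* Initial knowledge of a vertex: its ID and, for each port, the IDs of the
   vertices of the edge behind that port.  The IDs are sorted so that the
   enumeration of the finite type V is not disclosed. *)
Record view := View { own_id : nat; port_ids : seq (seq nat) }.

Definition local_view (V : finType) (N : network V) (v : V) : view :=
  View (id N v)
    [seq sort leq [seq id N u | u <- enum e] | e : {set V} <- ports N v].

Inductive model := EB | PC.

(* Messages are addressed by port number in EB, and by the ID of the recipient
   in PC.  A received message is indexed by port and sender ID in EB, and by
   sender ID in PC.  None stands for the absence of a message. *)
Definition inbox (M : model) (msg : Type) : Type :=
  match M with
  | EB => nat -> nat -> option msg
  | PC => nat -> option msg
  end.

(* A vertex halts as soon as output returns Some o; o is then its output. *)
Record algorithm (M : model) (msg out : Type) := Algorithm {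
  state : Type;
  init : view -> state;
  send : state -> nat -> option msg;
  receive : state -> inbox M msg -> state;
  output : state -> option out }.

Section Execution.

Variables (V : finType) (N : network V) (msg : Type).

Definition eb_deliver (snd : V -> nat -> option msg) (u : V) :
    inbox EB msg := fun p x =>
  let e := nth set0 (ports N u) p in
  if [pick w in e | id N w == x] is Some w
  then snd w (index e (ports N w)) else None.

Definition primal_adj (u w : V) : bool :=
  (u != w) && [exists e in edges (hyp N), (u \in e) && (w \in e)].

Definition pc_deliver (snd : V -> nat -> option msg) (u : V) :
    inbox PC msg := fun x =>
  if [pick w | primal_adj u w && (id N w == x)] is Some w
  then snd w (id N u) else None.

Definition deliver (M : model) :
    (V -> nat -> option msg) -> V -> inbox M msg :=
  match M with EB => eb_deliver | PC => pc_deliver end.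

Variables (M : model) (out : Type) (A : algorithm M msg out).

(* A halted vertex sends nothing and never changes its state. *)
Definition emit (s : state A) (k : nat) : option msg :=
  if output s is Some _ then None else send s k.

Definition round (st : V -> state A) (u : V) : state A :=
  if output (st u) is Some _ then st u
  else receive (st u) (deliver M (fun w => emit (st w)) u).

Definition run (t : nat) : V -> state A :=
  iter t round (fun v => init A (local_view N v)).

Definition halts_within (T : nat) (o : V -> out) : Prop :=
  forall v, output (run T v) = Some (o v).

End Execution.

(* The vertices output codes of objects; each code must denote an object of A,
   and the sets of objects denoted by the outputs must partition A. *)
Definition enumerates (V X : finType) (code : eqType)
    (denotes : code -> X -> bool) (A : {set X}) (o : V -> seq code) : Prop :=
  let O v := [set x in A | has (denotes^~ x) (o v)] in
  [/\ forall v c, c \in o v -> exists2 x, x \in A & denotes c x,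
      forall u v, u != v -> [disjoint O u & O v]
    & \bigcup_v O v = A].

(* With O(log n)-bit messages and unbounded rank, a vertex of a triangle cannot
   in general learn the vertex set of the opposite edge in O(Delta) rounds.
   Edges are therefore output by name: every vertex outputs a name for the edge
   behind each of its ports (first component), all vertices of an edge use the
   same name, and different edges have different names.  A triangle is output
   as the sequence of its vertex IDs and edge names, read from any starting
   vertex in either direction. *)
Definition tri_out : Type := (seq nat * seq {ffun 'I_3 -> nat * nat})%type.

Definition denotes_cycle (V : finType) (N : network V)
    (name : {set V} -> nat) (c : {ffun 'I_3 -> nat * nat}) (t : cyc3 V) :
    bool :=
  [exists t', same_cycle t t' &&
     (c == [ffun i => (id N (t' i).1, name (t' i).2)])].

Definition enumerates_cycles (V : finType) (N : network V)
    (P : pred (cyc3 V)) (o : V -> tri_out) : Prop :=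
  exists name : {set V} -> nat,
    [/\ {in edges (hyp N) &, injective name},
        forall v, (o v).1 = [seq name e | e <- ports N v]
      & enumerates (denotes_cycle N name) [set t | P t] (fun v => (o v).2)].

Definition enumerates_triangles (V : finType) (N : network V) :
    (V -> tri_out) -> Prop := enumerates_cycles N (triangle (hyp N)).

Definition enumerates_induced_triangles (V : finType) (N : network V) :
    (V -> tri_out) -> Prop := enumerates_cycles N (induced_triangle (hyp N)).

(* A simplex is output as the list of the IDs of its vertices. *)
Definition denotes_set (V : finType) (N : network V) (c : seq nat)
    (S : {set V}) : bool :=
  perm_eq c [seq id N u | u <- enum S].

Definition enumerates_simplices (V : finType) (N : network V)
    (o : V -> seq (seq nat)) : Prop :=
  enumerates (denotes_set N) [set S | simplex (hyp N) S] o.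

(* Main.v *)
(* Every edge is led by its vertex of minimum ID, and is named by the pair
   (ID of the leader, index of the edge among those led by that vertex).
   In round i a leader pings the members of its i-th edge.  A vertex knows
   which of its edges a given leader leads and in which order, so that the
   arrival times of the pings tell it the indices: after at most Delta rounds
   it can name all its edges.

   A vertex then tells its neighbours the names of its edges.  An index may
   need Delta bits, but indices need not be sent one by one: listing the leaders
   of the edges of index 0, then those of index 1, and so on, takes at most
   Delta IDs and Delta separators, i.e. O(Delta) messages.

   From these lists a vertex can decide, for all vertices w in its closed
   neighbourhood and all edges e meeting it, whether w lies on e; this suffices
   to find the triangles and simplices of which it is the vertex of minimum ID.
   For the simplices, an edge that contains r vertices consists of just these,
   r being the rank. *)
From Pilot Require Import Defs.
From mathcomp Require Import all_boot all_algebra.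
From mathcomp Require Import zify.
(* MathComp's id would otherwise shadow the ID map of a network. *)
Import Pilot.Defs.

Set Implicit Arguments.
Unset Strict Implicit.
Unset Printing Implicit Defensive.

(** * Naming edges and listing names *)

(** Here [D] lists the edges of a leader and [p] selects those containing the listener. Pings arrive
    at the positions selected by [p], so the time of the [k]-th ping is the position in [D] of the
    [k]-th selected edge. *)
Lemma nth_index_filter (T : eqType) (x0 s : T) (p : pred T) (D : seq T) :
  uniq D -> s \in D -> p s ->
  nth 0 [seq i <- iota 0 (size D) | p (nth x0 D i)] (index s (filter p D))
  = index s D.
Proof.
move=> uD sD ps; set I := filter _ (iota _ _).
have fE : filter p D = map (nth x0 D) I.
  by rewrite -{1}(take_size D) -(map_nth_iota0 x0 (leqnn _)) filter_map.
have sF : s \in filter p D by rewrite mem_filter ps.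
have ltk : index s (filter p D) < size I by rewrite -(size_map (nth x0 D)) -fE index_mem.
have := mem_nth 0 ltk; rewrite mem_filter mem_iota => /and3P[_ _ lti].
have sE : nth x0 D (nth 0 I (index s (filter p D))) = s.
  by rewrite -(nth_map 0 x0) // -fE nth_index.
by rewrite -[in RHS]sE index_uniq.
Qed.

(** Leader and members must order the same edges alike without communicating, so the order depends
    only on the IDs in the edges. *)
Definition code_le (s t : seq nat) := pickle s <= pickle t.

Lemma code_le_total : total code_le.
Proof. by move=> s t; apply: leq_total. Qed.

Lemma code_le_trans : transitive code_le.
Proof. by move=> s t u; apply: leq_trans. Qed.

Lemma code_le_anti : antisymmetric code_le.
Proof. by move=> s t /anti_leq; apply: (pcan_inj pickleK). Qed.

Definition led (P : seq (seq nat)) (x : nat) : seq (seq nat) :=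
  sort code_le [seq s <- P | head 0 s == x].

(** Sorting by a total antisymmetric order depends only on the multiset and commutes with filtering,
    so a local list is a subsequence of the global one. *)
Lemma led_filter (P E : seq (seq nat)) (p : pred (seq nat)) (x : nat) :
  perm_eq P (filter p E) -> led P x = filter p (led E x).
Proof.
move=> /(perm_filter (fun s => head 0 s == x)) eqP.
rewrite /led (filter_sort code_le_total code_le_trans).
apply/(perm_sortP code_le_total code_le_trans code_le_anti).
by rewrite (perm_trans eqP) // -!filter_predI; under eq_filter do rewrite /= andbC.
Qed.

(** * Lists of names as sequences of tokens *)

Definition height (ps : seq (nat * nat)) : nat := \max_(p <- ps) p.2.+1.

Definition tokens (ps : seq (nat * nat)) : seq (option nat) :=
  flatten [seq rcons [seq Some p.1 | p <- ps & p.2 == i] None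
          | i <- iota 0 (height ps)].

Fixpoint untokens (i : nat) (ts : seq (option nat)) : seq (nat * nat) :=
  match ts with
  | [::] => [::]
  | None :: ts' => untokens i.+1 ts'
  | Some x :: ts' => (x, i) :: untokens i ts'
  end.

Lemma ltn_height (ps : seq (nat * nat)) p : p \in ps -> p.2 < height ps.
Proof. by move=> pps; exact: (@leq_bigmax_seq _ ps xpredT (fun q => q.2.+1) p pps). Qed.

Lemma height_leP ps t : reflect {in ps, forall p, p.2 < t} (height ps <= t).
Proof. by apply: (iffP (bigmax_leqP_seq _ _ _ _)) => H p; [|move=> + _]; move/H; apply. Qed.

Lemma untokens_tokens ps : untokens 0 (tokens ps) =i ps.
Proof.
(* The index [j] of the first group is generalised. Decoding returns the pairs grouped by index,
   hence only the same set of pairs. *)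
suff E m j : untokens j (flatten [seq rcons [seq Some p.1 | p <- ps & p.2 == i] None
     | i <- iota j m]) = flatten [seq [seq p <- ps | p.2 == i] | i <- iota j m].
  move=> p; rewrite /tokens E; apply/flatten_mapP/idP => [[i _]|pps].
    by rewrite mem_filter => /andP[].
  by exists p.2; rewrite ?mem_filter ?eqxx // mem_iota ltn_height.
elim: m j => //= m IH j; rewrite -IH {IH}; move: (flatten _) => ts.
elim: ps => //= -[x k] ps IHps; case: eqP => //= ->; by rewrite IHps.
Qed.

Lemma size_tokens ps : size (tokens ps) <= size ps + height ps.
Proof.
rewrite /tokens; move: (height ps) => m.
(* The induction adds one group at a time, so only pairs of index below [m] may be charged. *)
suff: size (flatten [seq rcons [seq Some p.1 | p <- ps & p.2 == i] None
     | i <- iota 0 m]) <= count (fun p => p.2 < m) ps + m.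
  by move=> /leq_trans; apply; rewrite leq_add2r count_size.
elim: m => // m IH; rewrite -addn1 iotaD map_cat flatten_cat size_cat /= cats0.
rewrite size_rcons size_map size_filter addnA addn1 addnS ltnS.
have -> : count (fun p => p.2 < m + 1) ps =
    count (fun p => p.2 < m) ps + count (fun p : nat * nat => p.2 == m) ps.
  by elim: ps {IH} => //= p ps ->; lia.
by rewrite [leqRHS]addnAC leq_add2r.
Qed.

Lemma tokens_gt0 ps : ps != [::] -> 0 < size (tokens ps).
Proof.
case: ps => // p ps _; rewrite /tokens.
have: 0 < height (p :: ps) by rewrite (leq_trans _ (@ltn_height _ p _)) ?mem_head.
by case: (height _) => //= m _; rewrite size_cat size_rcons.
Qed.
Lemma tokens_mem ps x : Some x \in tokens ps -> exists i, (x, i) \in ps.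
Proof.
case/flatten_mapP => i _; rewrite mem_rcons inE /= => /mapP[[y j]].
by rewrite mem_filter => /andP[_ yj] [->]; exists j.
Qed.

(** * The protocol *)

Section Blocks.

Variables (msg : finType) (m0 : msg) (W : nat).

Definition num (k : option nat) : nat := if k is Some x then x.+1 else 0.

(** An ID need not fit into one message, so a token becomes the [W]-tuple of messages with number
    [num k]; number 0 is reserved for the separator. *)
Definition block (k : option nat) : W.-tuple msg :=
  nth [tuple of nseq W m0] (enum {: W.-tuple msg}) (num k).

Definition unblock (s : seq msg) : option nat :=
  if insub s is Some b then
    if index b (enum {: W.-tuple msg}) is x.+1 then Some x else None
  else None.

Lemma blockK k : num k < #|msg| ^ W -> unblock (block k) = k.
Proof.
move=> ltk; rewrite /unblock valK /block index_uniq ?enum_uniq -?cardE ?card_tuple //.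
by case: k {ltk}.
Qed.

Definition stream (ps : seq (nat * nat)) : seq msg :=
  flatten [seq val (block k) | k <- tokens ps].

Definition unstream (s : seq msg) : seq (nat * nat) :=
  untokens 0 [seq unblock b | b <- reshape (nseq (size s %/ W) W) s].

Lemma size_stream ps : size (stream ps) = size (tokens ps) * W.
Proof.
rewrite /stream size_flatten /shape -map_comp.
under eq_map do rewrite /= size_tuple.
by rewrite sumnE big_map big_const_seq count_predT iter_addn_0 mulnC.
Qed.

Lemma unstreamK ps : 0 < W ->
  {in ps, forall p, p.1.+1 < #|msg| ^ W} -> unstream (stream ps) =i ps.
Proof.
move=> W_gt0 ltps p; rewrite -[RHS]untokens_tokens /unstream size_stream mulnK //.
have -> : nseq (size (tokens ps)) W = shape [seq val (block k) | k <- tokens ps].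
  rewrite /shape -map_comp; elim: (tokens ps) => //= k ts ->.
  by rewrite size_tuple.
rewrite flattenK -map_comp map_id_in // => -[x|] xt /=; apply: blockK => /=.
  by have [i /ltps] := tokens_mem xt.
(* A separator has number 0, so [#|msg| ^ W] must be positive; any pair of the list shows this, and
   an empty list has no tokens. *)
case: (ps) ltps xt => [|q qs /(_ q (mem_head _ _)) /(leq_trans _)-> //].
by rewrite /tokens /height big_nil.
Qed.

End Blocks.

(** * The local rules of a vertex *)

Section Protocol.

Variables (msg : finType) (m0 : msg) (W : nat) (out : Type).
Variable post : nat -> seq nat -> seq (nat * nat) -> out.

(** Entry [t] maps a sender ID to what was heard from it in round [t]; the length serves as the
    clock. *)
Definition history : Type := seq (nat -> option msg).

Implicit Types (vw : view) (h : history) (s : seq nat) (x : nat).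

Definition heard h x : seq nat :=
  [seq t <- iota 0 (size h) | isSome (nth (fun=> None) h t x)].

(** The first messages heard from a leader are its pings, one per shared edge in the common order,
    so the [k]-th arrival time is the index of the [k]-th shared edge. *)
Definition label vw h s : nat * nat :=
  (head 0 s, nth 0 (heard h (head 0 s)) (index s (led (port_ids vw) (head 0 s)))).

Definition labels vw h : seq (nat * nat) := [seq label vw h s | s <- port_ids vw].

Definition labelled vw h : bool :=
  all (fun s => size (led (port_ids vw) (head 0 s)) <= size (heard h (head 0 s)))
      (port_ids vw).

Definition say vw h : option msg :=
  if size h < size (led (port_ids vw) (own_id vw)) then Some m0
  else if labelled vw h then
    let ls := labels vw h in
    if height ls <= size h then onth (stream m0 W ls) (size h - height ls) else None
  else None.

Definition aim vw h s : bool :=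
  let D := led (port_ids vw) (own_id vw) in
  (size h < size D) ==> (s == nth [::] D (size h)).

Definition tell vw h x : option msg :=
  if has (fun s => aim vw h s && (x \in s)) (port_ids vw) then say vw h else None.

(* A vertex first sends its pings, then its list without interruption; a list
   has ended when silence follows. *)
Definition tail_of vw h x : seq nat := drop (size (led (port_ids vw) x)) (heard h x).

Definition complete vw h x : bool :=
  (tail_of vw h x != [::]) && ((last 0 (tail_of vw h x)).+1 < size h).

Definition received vw h x : seq msg :=
  [seq odflt m0 (nth (fun=> None) h t x) | t <- tail_of vw h x].

Definition names vw h : seq nat := [seq pickle l | l <- labels vw h].

Definition knowledge vw h : seq (nat * nat) :=
  flatten [seq [seq (x, pickle l) | l <- if x == own_id vw then labels vw h
                                        else unstream W (received vw h x)]
          | x <- flatten (port_ids vw)].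

Definition result vw h : option out :=
  if all (complete vw h) (flatten (port_ids vw)) then
    Some (post (own_id vw) (names vw h) (knowledge vw h))
  else None.

Definition address (M : model) vw h (k : nat) : option msg :=
  match M with
  | EB => if (k < size (port_ids vw)) && aim vw h (nth [::] (port_ids vw) k)
          then say vw h else None
  | PC => tell vw h k
  end.

(** In EB a neighbour may be heard through several shared edges in one round; all copies are equal,
    so the first is kept. *)
Definition hear (M : model) vw : inbox M msg -> nat -> option msg :=
  match M with
  | EB => fun ib x => head None [seq ib p x | p <- iota 0 (size (port_ids vw))
                                            & isSome (ib p x)]
  | PC => fun ib x => ib x
  end.

(* A vertex records its own messages as if it had received them: EB delivers
   them to the sender, PC does not. *)
Definition protocol (M : model) : algorithm M msg out :=
  @Algorithm M msg out (view * history)%type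
    (fun vw => (vw, [::]))
    (fun st => address M st.1 st.2)
    (fun st ib => (st.1, rcons st.2 (fun x =>
       if x == own_id st.1 then tell st.1 st.2 x else @hear M st.1 ib x)))
    (fun st => result st.1 st.2).

End Protocol.

(** * Codes, leaders and names of edges *)

Section Codes.

Variables (V : finType) (N : network V).

Definition code (e : {set V}) : seq nat := sort leq [seq id N u | u <- enum e].

Definition portcodes (v : V) : seq (seq nat) := port_ids (local_view N v).

Definition allcodes : seq (seq nat) := [seq code e | e <- enum (edges (hyp N))].

Lemma portcodesE v : portcodes v = [seq code e | e <- ports N v].
Proof. by []. Qed.

Lemma mem_code e u : (id N u \in code e) = (u \in e).
Proof. by rewrite mem_sort mem_map ?mem_enum //; apply: id_inj. Qed.

Lemma codeP e x : x \in code e -> exists2 u, u \in e & x = id N u.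
Proof. by rewrite mem_sort => /mapP[u]; rewrite mem_enum; exists u. Qed.

Lemma code_inj : injective code.
Proof. by move=> e f ef; apply/setP => u; rewrite -!mem_code ef. Qed.

Lemma mem_ports v e : (e \in ports N v) = (e \in edges (hyp N)) && (v \in e).
Proof. by rewrite (perm_mem (portsP N v)) mem_enum inE. Qed.

Lemma uniq_ports v : uniq (ports N v).
Proof. by rewrite (perm_uniq (portsP N v)) enum_uniq. Qed.

Lemma size_portcodes v : size (portcodes v) = deg (hyp N) v.
Proof. by rewrite size_map (perm_size (portsP N v)) -cardE. Qed.

Lemma portcodesP v s :
  reflect (exists e, [/\ e \in edges (hyp N), v \in e & s = code e])
          (s \in portcodes v).
Proof.
apply: (iffP mapP) => [[e]|[e [eH ve ->]]]; first by rewrite mem_ports => /andP[]; exists e.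
by exists e; rewrite // mem_ports eH.
Qed.

Lemma mem_portcodes v e :
  (code e \in portcodes v) = (e \in edges (hyp N)) && (v \in e).
Proof. by rewrite portcodesE mem_map ?mem_ports //; apply: code_inj. Qed.

Lemma uniq_portcodes v : uniq (portcodes v).
Proof. by rewrite map_inj_uniq ?uniq_ports //; apply: code_inj. Qed.

Lemma mem_allcodes e : (code e \in allcodes) = (e \in edges (hyp N)).
Proof. by rewrite mem_map ?mem_enum //; apply: code_inj. Qed.

Lemma uniq_allcodes : uniq allcodes.
Proof. by rewrite map_inj_uniq ?enum_uniq //; apply: code_inj. Qed.

Lemma perm_portcodes v : perm_eq (portcodes v) [seq s <- allcodes | id N v \in s].
Proof.
apply: uniq_perm; rewrite ?filter_uniq ?uniq_portcodes ?uniq_allcodes // => s.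
rewrite mem_filter; apply/portcodesP/andP => [[e [eH ve ->]]|[+ /mapP[e]]].
  by rewrite mem_code mem_allcodes.
by rewrite mem_enum => + eH sE; rewrite sE mem_code; exists e.
Qed.

Lemma head_code e : e \in edges (hyp N) -> head 0 (code e) \in code e.
Proof.
move=> eH; rewrite -nth0 mem_nth // size_sort size_map -cardE card_gt0.
by apply: contraTneq eH => ->; apply: edges_nonempty.
Qed.

Definition near (v w : V) : bool :=
  [exists e in edges (hyp N), (v \in e) && (w \in e)].

Lemma near_sym v w : near v w = near w v.
Proof. by apply: eq_existsb => e; rewrite [(v \in e) && _]andbC. Qed.

Lemma mem_flatten_portcodes v w : (id N w \in flatten (portcodes v)) = near v w.
Proof.
apply/flattenP/existsP => [[s /portcodesP[e [eH ve ->]]]|[e /and3P[eH ve we]]].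
  by rewrite mem_code => we; exists e; rewrite eH ve.
by exists (code e); rewrite ?mem_code // mem_portcodes eH.
Qed.

Lemma flatten_portcodesP v x :
  x \in flatten (portcodes v) -> exists2 w, near v w & x = id N w.
Proof.
move=> xP; case/flattenP: (xP) => s /portcodesP[e [_ _ ->]] /codeP[w _ xE].
by exists w; rewrite // -mem_flatten_portcodes -xE.
Qed.

Definition gled (x : nat) : seq (seq nat) := led allcodes x.

Definition gindex (s : seq nat) : nat := index s (gled (head 0 s)).

Definition name (e : {set V}) : nat := pickle (head 0 (code e), gindex (code e)).

Lemma led_portcodes v x : led (portcodes v) x = [seq s <- gled x | id N v \in s].
Proof. exact: led_filter (perm_portcodes v). Qed.

Lemma mem_gled e x :
  (code e \in gled x) = (e \in edges (hyp N)) && (head 0 (code e) == x).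
Proof. by rewrite mem_sort mem_filter mem_allcodes andbC. Qed.

Lemma gledP x s :
  reflect (exists e, [/\ e \in edges (hyp N), s = code e & head 0 s = x])
          (s \in gled x).
Proof.
rewrite mem_sort mem_filter; apply: (iffP andP) => [[/eqP <- /mapP[e]]|[e [eH -> <-]]].
  by rewrite mem_enum => eH sE; exists e.
by rewrite eqxx mem_allcodes.
Qed.

Lemma uniq_gled x : uniq (gled x).
Proof. by rewrite sort_uniq filter_uniq ?uniq_allcodes. Qed.

(** A leader lies on every edge it leads, so its local list is already the global one. *)
Lemma led_own v : led (portcodes v) (id N v) = gled (id N v).
Proof.
rewrite led_portcodes; apply/all_filterP/allP => s /gledP[e [eH -> <-]].
exact: head_code.
Qed.

(** Equal leaders give the same list, and the index in that list determines the code. *)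
Lemma name_inj : {in edges (hyp N) &, injective name}.
Proof.
move=> e f eH fH /(pcan_inj pickleK)[hE]; rewrite /gindex hE => iE.
apply: code_inj; rewrite -[LHS](nth_index [::] (s := gled (head 0 (code f)))).
  by rewrite iE nth_index // mem_gled fH eqxx.
by rewrite mem_gled eH hE eqxx.
Qed.

End Codes.

(** * Correctness of the protocol *)

Section Ideal.

Variables (V : finType) (N : network V).
Variables (msg : finType) (m0 : msg) (W : nat).
Hypothesis W_gt0 : 0 < W.
(** The capacity is demanded only when two distinct vertices exist: a lone vertex decodes no list,
    and [theta_log] says nothing about [B 1]. *)
Hypothesis fit : forall u v : V, u != v -> forall w, (id N w).+1 < #|msg| ^ W.

Implicit Types (u v w : V) (t : nat) (h : history msg).

(** * The intended course of the communication *)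

Definition glabel (s : seq nat) : nat * nat := (head 0 s, gindex N s).

Definition glabels v : seq (nat * nat) := [seq glabel s | s <- portcodes N v].

(** An edge of index [i] is pinged in round [i], so this is the time from which [v] can name all its
    edges and begin its list. *)
Definition start v : nat := height (glabels v).

Definition script v : seq msg := stream m0 W (glabels v).

Definition stop v : nat := start v + size (script v).

(** This is the message from [w] to [u] in round [t] as a function of the network alone; the
    execution is later shown to follow it. *)
Definition sent w u t : option msg :=
  if t < size (gled N (id N w)) then
    if id N u \in nth [::] (gled N (id N w)) t then Some m0 else None
  else if start w <= t then onth (script w) (t - start w) else None.

Definition pings w u : seq nat :=
  [seq i <- iota 0 (size (gled N (id N w))) |
     id N u \in nth [::] (gled N (id N w)) i].

Lemma mem_pings w u i :
  (i \in pings w u) = (i < size (gled N (id N w))) &&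
     (id N u \in nth [::] (gled N (id N w)) i).
Proof. by rewrite mem_filter mem_iota andbC. Qed.

(** The last edge led by [w] is also an edge of [w], so its index counts towards [start w]. Hence
    pings and list never overlap. *)
Lemma size_gled_start w : size (gled N (id N w)) <= start w.
Proof.
case E: (size _) => [//|k].
have ltk : k < size (gled N (id N w)) by rewrite E.
have /gledP[e [eH sE hE]] := mem_nth [::] ltk.
have -> : k = (glabel (nth [::] (gled N (id N w)) k)).2.
  by rewrite /= /gindex hE index_uniq // uniq_gled.
apply: ltn_height; apply: map_f; rewrite sE mem_portcodes eH.
by rewrite -(mem_code N) -hE sE head_code.
Qed.

Lemma start_stop w u : near N w u -> start w < stop w.
Proof.
case/existsP => e /and3P[eH we _].
rewrite -addn1 leq_add2l size_stream muln_gt0 W_gt0 andbT tokens_gt0 //.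
have /(map_f glabel): code N e \in portcodes N w by rewrite mem_portcodes eH.
by rewrite -/(glabels w); case: (glabels w).
Qed.

Lemma sent_times w u t :
  [seq i <- iota 0 t | isSome (sent w u i)] =
  [seq i <- pings w u | i < t] ++ iota (start w) (minn t (stop w) - start w).
Proof.
have le_start := size_gled_start w.
(* Both sides are strictly increasing, so comparing members suffices. *)
apply: (irr_sorted_eq ltn_trans ltnn).
- exact: sorted_filter ltn_trans _ _ (iota_ltn_sorted _ _).
- rewrite sorted_pairwise ?pairwise_cat; last exact: ltn_trans.
  rewrite -!sorted_pairwise ?iota_ltn_sorted; try exact: ltn_trans.
  rewrite !(sorted_filter ltn_trans) ?iota_ltn_sorted // !andbT.
  apply/allrelP => i j; rewrite mem_filter mem_pings mem_iota.
  by move=> /and3P[_ lti _] /andP[/(leq_trans _) + _]; apply; apply: leq_trans lti le_start.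
move=> i; rewrite mem_cat mem_filter [i \in filter _ _]mem_filter mem_pings !mem_iota /sent /stop.
case: ltnP => [lti|lei] /=.
  have -> : start w <= i = false by apply/negbTE; rewrite -ltnNge (leq_trans lti).
  by rewrite orbF andbC; case: (_ \in _); rewrite /= ?andbT ?andbF.
rewrite andbF orFb; case: (leqP (start w) i) => [lesi|_] /=; last by [].
rewrite onthTE; lia.
Qed.

Definition agrees u h : Prop := forall t w, t < size h -> near N u w ->
  nth (fun=> None) h t (id N w) = sent w u t.

(** * What a vertex reconstructs from a correct history *)

Section Reconstruction.

Variables (u : V) (h : history msg).
Hypothesis agr : agrees u h.

Let vw := local_view N u.

Lemma heardE w : near N u w -> heard h (id N w) =
  [seq i <- pings w u | i < size h] ++
  iota (start w) (minn (size h) (stop w) - start w).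
Proof.
move=> nuw; rewrite -sent_times /heard; apply: eq_in_filter => t.
by rewrite mem_iota => /andP[_ lt]; rewrite agr.
Qed.

Lemma size_led w : size (led (port_ids vw) (id N w)) = size (pings w u).
Proof.
rewrite -/(portcodes N u) led_portcodes /pings !size_filter.
rewrite -[in LHS](take_size (gled N (id N w))) -(map_nth_iota0 [::] (leqnn _)).
by rewrite count_map; apply: eq_count.
Qed.

Lemma leader s : s \in portcodes N u -> exists w,
  [/\ near N u w, head 0 s = id N w & s \in gled N (id N w)].
Proof.
case/portcodesP => e [eH ue ->]; have /codeP[w we hE] := head_code eH.
exists w; split=> //; last by rewrite mem_gled eH hE /=.
by apply/existsP; exists e; rewrite eH ue.
Qed.

(** A mere count detects the arrival of all pings: before [start w] only pings are heard, and from
    then on none is outstanding. *)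
Lemma heard_all w : near N u w ->
  (size (pings w u) <= size (heard h (id N w))) = all (fun i => i < size h) (pings w u).
Proof.
move=> nuw; rewrite (heardE nuw) size_cat size_iota size_filter all_count.
have := size_gled_start w; case: (leqP (start w) (size h)) => [le1 le2|lt1 le2].
  have /eqP-> : count (fun i => i < size h) (pings w u) == size (pings w u).
    rewrite -all_count; apply/allP => i; rewrite mem_pings => /andP[lti _].
    by rewrite (leq_trans lti) // (leq_trans le2).
  by rewrite leq_addr eqxx.
have -> : minn (size h) (stop w) - start w = 0 by lia.
by rewrite addn0 eqn_leq count_size.
Qed.

(** Since index and ping time coincide, awaiting all pings means awaiting the largest index among
    the edges of [u]. *)
Lemma labelledE : labelled vw h = (start u <= size h).
Proof.
apply/allP/height_leP => [H p /mapP[s sP ->] /=|H s sP].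
  have [w [nuw hE sG]] := leader sP; have := H s sP.
  rewrite hE size_led heard_all // => /allP; apply.
  rewrite /gindex hE mem_pings index_mem sG nth_index //.
  by case/portcodesP: sP => e [_ ue ->]; rewrite mem_code.
have [w [nuw -> _]] := leader sP; rewrite size_led heard_all //.
apply/allP => i; rewrite mem_pings => /andP[lti ui].
have /gledP[e [eH sE hE]] := mem_nth [::] lti.
have eP : nth [::] (gled N (id N w)) i \in portcodes N u.
  by rewrite sE mem_portcodes eH -(mem_code N) -sE.
by have := H _ (map_f glabel eP); rewrite /= /gindex hE index_uniq // uniq_gled.
Qed.

Lemma labelsE : labelled vw h -> labels vw h = glabels u.
Proof.
move=> /allP lab; apply/eq_in_map => s sP; congr (_, _).
have [w [nuw hE sG]] := leader sP; rewrite /gindex hE.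
have us : id N u \in s by case/portcodesP: sP => e [_ ue ->]; rewrite mem_code.
have := lab s sP; rewrite hE size_led heard_all // => /all_filterP allP.
(* The position falls into the initial segment of pings, where [nth_index_filter] recovers the
   global index. *)
rewrite heardE // allP led_portcodes nth_cat.
have -> : index s [seq s <- gled N (id N w) | id N u \in s] < size (pings w u).
  by rewrite -size_led led_portcodes index_mem mem_filter us sG.
by rewrite (nth_index_filter [::] (p := fun s => id N u \in s)) ?uniq_gled.
Qed.

Lemma tell_sent w : near N u w -> tell m0 W vw h (id N w) = sent u w (size h).
Proof.
move=> nuw; rewrite /tell /say /aim /sent labelledE -/(portcodes N u) !led_own.
case: ltnP => [lth|leh] /=.
  have sG := mem_nth [::] lth; set s := nth _ _ _ in sG *.
  have sP : s \in portcodes N u.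
    case/gledP: sG => e [eH -> hE]; rewrite mem_portcodes eH -(mem_code N) -hE.
    exact: head_code.
  congr (if _ then _ else _); apply/hasP/idP => [[s' _ /andP[/eqP-> ]] //|ws].
  by exists s; rewrite // eqxx.
have -> : has (fun s => id N w \in s) (portcodes N u).
  by move: nuw; rewrite -mem_flatten_portcodes => /flattenP[s sP ws]; apply/hasP; exists s.
case: leqP => // le; rewrite labelsE ?labelledE //.
by rewrite -/(start u) le.
Qed.

Lemma tail_ofE w : near N u w ->
  tail_of vw h (id N w) = iota (start w) (minn (size h) (stop w) - start w).
Proof.
move=> nuw; rewrite /tail_of size_led heardE //.
have le2 := size_gled_start w; case: (leqP (start w) (size h)) => [le1|lt1].
  have /all_filterP-> : all (fun i => i < size h) (pings w u); last by rewrite drop_size_cat.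
  apply/allP => i; rewrite mem_pings => /andP[lti _].
  by rewrite (leq_trans lti) // (leq_trans le2).
have -> : minn (size h) (stop w) - start w = 0 by lia.
by rewrite cats0 drop_oversize // size_filter count_size.
Qed.

(** One silent round after the list must be recorded, whence the strict inequality. By [start_stop]
    the list is nonempty, so there is a last message to look for. *)
Lemma completeE w : near N u w -> complete vw h (id N w) = (stop w < size h).
Proof.
move=> nuw; rewrite /complete tail_ofE //.
have lt1 : start w < stop w by apply: (@start_stop _ u); rewrite near_sym.
case E: (_ - _) => [|k] /=; first by lia.
by have := nth_last 0 (iota (start w) k.+1); rewrite size_iota nth_iota //= => <-; lia.
Qed.

Lemma receivedE w : near N u w -> stop w < size h ->
  received m0 vw h (id N w) = script w.
Proof.
move=> nuw ltw; rewrite /received tail_ofE //.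
have -> : minn (size h) (stop w) - start w = size (script w).
  by rewrite (minn_idPr (ltnW ltw)) addKn.
apply: (@eq_from_nth _ m0) => [|i]; rewrite size_map size_iota // => lti.
have ltiw : start w + i < size h by apply: leq_ltn_trans ltw; rewrite leq_add2l ltnW.
rewrite (nth_map 0) ?size_iota // nth_iota // agr // /sent.
rewrite ltnNge (leq_trans (size_gled_start w) (leq_addr _ _)) /= leq_addr addKn.
by rewrite odflt_onth.
Qed.

End Reconstruction.

Lemma near_refl u w : near N u w -> near N u u.
Proof.
by case/existsP => e /and3P[eH ue _]; apply/existsP; exists e; rewrite eH ue.
Qed.

(** This is the least history length at which all lists of the closed neighbourhood are recognised
    as complete; it is 0 for a vertex on no edge. *)
Definition finish v : nat := \max_(w | near N v w) (stop w).+1.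

Definition known v : seq (nat * nat) :=
  [seq (id N p.1, name N p.2) | p <- enum {: V * {set V}} &
     [&& near N v p.1, p.2 \in edges (hyp N) & p.1 \in p.2]].

Lemma unscript u w : u != w -> unstream W (script w) =i glabels w.
Proof.
move=> neq; apply: unstreamK => // p /mapP[s sP ->] /=.
have /portcodesP[e [eH _ ->]] := sP; have /codeP[z _ ->] := head_code eH.
exact: fit neq z.
Qed.

Lemma labelled_finish u h : agrees u h -> finish u <= size h ->
  labelled (local_view N u) h.
Proof.
move=> agr /bigmax_leqP le; apply/allP => s sP.
have: labelled (local_view N u) h; last by move/allP; apply.
have [w [nuw _ _]] := leader sP; have nuu := near_refl nuw.
by rewrite labelledE // ltnW // (ltn_trans (start_stop nuu)) // le.
Qed.

Lemma knowledgeE u h : agrees u h -> finish u <= size h ->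
  knowledge m0 W (local_view N u) h =i known u.
Proof.
move=> agr fin.
have lab := labelsE agr (labelled_finish agr fin).
have memK w : near N u w -> (if id N w == id N u then labels (local_view N u) h
    else unstream W (received m0 (local_view N u) h (id N w))) =i glabels w.
  move=> nuw p; case: (eqVneq (id N w) (id N u)) => [/id_inj->|neq]; first by rewrite lab.
  rewrite receivedE // ?(unscript (u := u)) //; first by apply: contraNneq neq => ->.
  by apply: leq_trans fin; apply: (leq_bigmax_cond w).
move=> [x k]; apply/flatten_mapP/mapP => [[y yP /mapP[l + [-> ->]]]|].
  have [w nuw yE] := flatten_portcodesP yP; rewrite yE /= memK //.
  case/mapP => s /portcodesP[e [eH we ->]] ->.
  by exists (w, e); rewrite // mem_filter mem_enum /= nuw eH we.
case=> [[w e]]; rewrite mem_filter => /andP[/and3P[/= nuw eH we] _] [-> ->].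
exists (id N w); first by rewrite mem_flatten_portcodes.
apply/mapP; exists (glabel (code N e)) => //.
by rewrite memK //; apply: map_f; rewrite mem_portcodes eH.
Qed.

Lemma resultE (out : Type) (post : nat -> seq nat -> seq (nat * nat) -> out) u h :
  agrees u h ->
  result m0 W post (local_view N u) h =
  if finish u <= size h then
    Some (post (id N u) [seq name N e | e <- ports N u]
               (knowledge m0 W (local_view N u) h))
  else None.
Proof.
move=> agr; rewrite /result.
have -> : all (complete (local_view N u) h) (flatten (port_ids (local_view N u)))
    = (finish u <= size h).
  apply/allP/bigmax_leqP => [cmp w nuw|le x /flatten_portcodesP[w nuw ->]].
    by rewrite -(completeE agr nuw) cmp // mem_flatten_portcodes.
  by rewrite completeE // le.
case: ifP => // fin; congr (Some (post _ _ _)).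
by rewrite /names labelsE ?labelled_finish // -!map_comp.
Qed.

(** A vertex on an edge is near itself and so waits for the end of its own list; halting therefore
    suppresses no message. *)
Lemma sent_finish u w t : near N u w -> finish u <= t -> sent u w t = None.
Proof.
move=> /near_refl nuu /bigmax_leqP/(_ u nuu) ltt.
have := start_stop nuu; have := size_gled_start u; rewrite /stop in ltt * => le1 lt1.
rewrite /sent ltnNge; have -> /= : size (gled N (id N u)) <= t by lia.
by case: leqP => // le; rewrite onth_default //; lia.
Qed.

Lemma head_filter_some (T : eqType) (A : Type) (f : T -> option A) (b : pred T) y (s : seq T) :
  {in s, forall p, f p = if b p then y else None} ->
  head None [seq f p | p <- s & isSome (f p)] = if has b s then y else None.
Proof.
elim: s => //= p s IH H; have {}IH := IH (fun q qs => H q (@mem_behead _ (p :: s) q qs)).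
have := H p (mem_head _ _); case: (b p) => /= {H} fp; last by rewrite fp IH.
by case: y fp IH => [a|] fp IH; rewrite fp /= ?fp // IH if_same.
Qed.

(** In EB every shared edge aimed at carries the same message and every other one carries nothing,
    so [head_filter_some] applies; in PC the message is addressed directly. *)
Lemma hear_deliver (M : model) (snd : V -> nat -> option msg) u w h :
  u != w -> near N u w ->
  (forall k, snd w k = address m0 W M (local_view N w) h k) ->
  @hear msg M (local_view N u) (@deliver V N msg M snd u) (id N w) =
  tell m0 W (local_view N w) h (id N u).
Proof.
move=> neq nuw; case: M => /= E; last first.
  rewrite /pc_deliver; case: pickP => [w' /andP[_ /eqP/id_inj->]|]; first by rewrite E.
  by move/(_ w); rewrite eqxx andbT /primal_adj neq [X in X = _]nuw.
rewrite (@head_filter_some _ _ _ (fun p => (w \in nth set0 (ports N u) p) &&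
    aim (local_view N w) h (code N (nth set0 (ports N u) p))) (say m0 W (local_view N w) h)).
  congr (if _ then _ else _); apply/hasP/hasP => [[p]|[s /portcodesP[e [eH we ->]]]].
    rewrite mem_iota size_map => /andP[_ ltp] /andP[we aime].
    have := mem_nth set0 ltp; set e := nth _ _ _ in we aime *.
    rewrite mem_ports => /andP[eH ue].
    by exists (code N e); rewrite ?mem_portcodes ?eH ?aime ?mem_code.
  rewrite mem_code => /andP[aime ue]; exists (index e (ports N u)).
    by rewrite mem_iota size_map index_mem mem_ports eH.
  by rewrite nth_index ?we ?mem_ports ?eH.
move=> p; rewrite mem_iota size_map => /andP[_ ltp]; rewrite /eb_deliver.
have := mem_nth set0 ltp; set e := nth _ _ _; rewrite mem_ports => /andP[eH ue].
case: pickP => [w' /andP[we /eqP/id_inj w'E]|]; last first.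
  by move/(_ w); rewrite eqxx andbT => ->.
rewrite -{}w'E in E *; rewrite we E /= size_map index_mem mem_ports eH we /=.
by rewrite (nth_map set0) ?index_mem ?nth_index ?mem_ports ?eH.
Qed.

Lemma hear_silence (M : model) (snd : V -> nat -> option msg) u w :
  (forall k, snd w k = None) ->
  @hear msg M (local_view N u) (@deliver V N msg M snd u) (id N w) = None.
Proof.
move=> E; case: M => /=; last first.
  by rewrite /pc_deliver; case: pickP => // w' /andP[_ /eqP/id_inj->].
rewrite (@head_filter_some _ _ _ pred0 None) ?if_same // => p _ /=.
by rewrite /eb_deliver; case: pickP => // w' /andP[_ /eqP/id_inj->].
Qed.

(** * The execution follows the intended course *)

Section Run.

Variables (M : model) (out : Type) (post : nat -> seq nat -> seq (nat * nat) -> out).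

(** Histories that agree with [sent] so far determine the messages of the next round, so the
    agreement propagates. The history of [v] freezes at length [finish v], when [v] halts. *)
Lemma run_agrees t v :
  let st := run N (protocol m0 W post M) t v in
  [/\ st.1 = local_view N v, agrees v st.2 & size st.2 = minn t (finish v)].
Proof.
elim: t v => [|t IH] v; first by split; rewrite ?min0n.
rewrite [run _ _ _]/(round N (run N (protocol m0 W post M) t)) /round.
have [viewv agrv sizev] := IH v.
set st := run _ _ _ in IH viewv agrv sizev *.
have outE w : output (st w) = result m0 W post (local_view N w) (st w).2.
  by have [<- _ _] := IH w.
rewrite outE resultE //; case: ifP => fin.
  by split=> //; rewrite sizev; move: fin; rewrite sizev; lia.
have size_t : size (st v).2 = t by move: fin; rewrite sizev; lia.
split=> //=; last by rewrite size_rcons size_t; move: fin; rewrite size_t; lia.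
move=> i w; rewrite size_rcons nth_rcons ltnS => lei nvw.
case: ltnP => [lti|gei]; first exact: agrv.
have -> : i = size (st v).2 by apply/eqP; rewrite eqn_leq lei.
rewrite eqxx viewv /=; case: (eqVneq (id N w) (id N v)) => [/id_inj->|neq].
  by rewrite tell_sent //; apply: near_refl nvw.
have {}neq : v != w by apply: contraNneq neq => ->.
have [vieww agrw sizew] := IH w; have nwv : near N w v by rewrite near_sym.
(* A halted neighbour is silent, as [sent] prescribes; one still running has a history of the same
   length [t], so [tell_sent] applies to the current round. *)
case: (leqP (finish w) (size (st w).2)) => finw.
  rewrite hear_silence => [|k]; last by rewrite /emit outE resultE // finw.
  by rewrite sent_finish // size_t; move: finw; rewrite sizew; lia.
rewrite (hear_deliver (h := (st w).2)) //.
  by rewrite tell_sent // size_t; congr sent; move: finw; rewrite sizew; lia.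
by move=> k; rewrite /emit outE resultE // leqNgt finw /= vieww.
Qed.

Lemma protocol_halts T : (forall v, finish v <= T) ->
  exists K : V -> seq (nat * nat), (forall v, K v =i known v) /\
    halts_within N (protocol m0 W post M) T
      (fun v => post (id N v) [seq name N e | e <- ports N v] (K v)).
Proof.
move=> le; exists (fun v => knowledge m0 W (local_view N v) (run N (protocol m0 W post M) T v).2).
split=> v; have [vw agr sz] := run_agrees T v.
  by apply: knowledgeE; rewrite // sz (minn_idPr _).
have -> : output (run N (protocol m0 W post M) T v) =
    result m0 W post (local_view N v) (run N (protocol m0 W post M) T v).2 by rewrite -vw.
by rewrite resultE // sz (minn_idPr _) ?leqnn.
Qed.

End Run.

(** * The bound on the number of rounds *)

Lemma deg_le v : deg (hyp N) v <= maxdeg (hyp N).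
Proof. exact: (leq_bigmax v). Qed.

Lemma start_le v : start v <= maxdeg (hyp N).
Proof.
apply/height_leP => _ /mapP[s sP ->] /=.
have [w [_ hE sG]] := leader sP; rewrite /gindex hE.
apply: leq_trans (deg_le w); rewrite -size_portcodes.
by apply: leq_trans (_ : size (gled N (id N w)) <= _); rewrite ?index_mem //
  -led_own size_sort size_filter count_size.
Qed.

Lemma finish_le v : finish v <= (2 * W + 2) * maxdeg (hyp N).
Proof.
apply/bigmax_leqP => w /existsP[e /and3P[eH ve we]].
(* With [D] the maximum degree, the list starts by round [D] and has at most [2 * D] tokens of [W]
   messages each. The final silent round is absorbed into another [D], which is positive. *)
have deg_gt0 : 0 < maxdeg (hyp N).
  by apply: leq_trans (deg_le v); rewrite card_gt0; apply/set0Pn; exists e; rewrite inE eH.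
have := start_le w; rewrite /stop size_stream.
have := size_tokens (glabels w); rewrite -/(start w) size_map size_portcodes.
have := deg_le w; move: (size _) (deg _ _) (start _) (maxdeg _) deg_gt0 => T d s D; nia.
Qed.

End Ideal.

(** The constants depend on [B] and [c] only, and [post] is arbitrary, so one protocol serves every
    enumeration problem. *)
Lemma gather (B : nat -> nat) (hB : theta_log B) (c : nat) (M : model) :
  exists W C : nat, forall (V : finType) (N : network V), short_ids c N ->
  forall (out : Type) (post : nat -> seq nat -> seq (nat * nat) -> out),
  exists K : V -> seq (nat * nat), (forall v, K v =i known N v) /\
    halts_within N (protocol [tuple of nseq (B #|V|) false] W post M)
      (C * maxdeg (hyp N))
      (fun v => post (id N v) [seq name N e | e <- ports N v] (K v)).
Proof.
(* For [n > 1] one has [B n > 0] and [n < 2 ^ (a.+1 * B n)], so [a.+1 * c] messages accommodate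
   [n ^ c]; the extra one makes the inequality strict and [W] positive. *)
have [a [b Bab]] := hB; pose W := a.+1 * c + 1.
exists W, (2 * W + 2) => V N short out post.
apply: protocol_halts; first by rewrite /W addn1.
- move=> u v neq w; have n_gt1 : 1 < #|V|.
    by have := max_card (pred2 u v); rewrite card2 neq.
  have /andP[leB _] := Bab _ n_gt1.
  have B_gt0 : 0 < B #|V|.
    by have := trunc_log_max (isT : 1 < 2) (n_gt1 : 2 ^ 1 <= #|V|); nia.
  apply: leq_ltn_trans (short w) _; rewrite card_tuple card_bool -expnM.
  apply: (@leq_ltn_trans (2 ^ (a.+1 * B #|V| * c))); last by rewrite ltn_exp2l // /W; nia.
  rewrite expnM; case: (c) => // c'; rewrite leq_exp2r //; apply: ltnW; apply: leq_trans (trunc_log_ltn #|V| (isT : 1 < 2)) _.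
  by rewrite leq_exp2l //; nia.
- by move=> v; apply: finish_le; rewrite /W addn1.
Qed.

(** * Triangles and simplices *)

Section Known.

Variables (V : finType) (N : network V).

Lemma knownP v p : reflect
  (exists w e, [/\ p = (id N w, name N e), near N v w, e \in edges (hyp N) & w \in e])
  (p \in known N v).
Proof.
apply: (iffP mapP) => [[[w e]]|[w [e [-> nvw eH we]]]].
  by rewrite mem_filter => /andP[/and3P[/= nvw eH we] _] ->; exists w, e.
by exists (w, e); rewrite // mem_filter mem_enum /= nvw eH we.
Qed.

(** Names separate only actual edges, whence the hypothesis. For [w] near [v], absence of the pair
    certifies that [w] is not on [e], which the test for induced triangles relies on. *)
Lemma mem_known v w e : e \in edges (hyp N) ->
  ((id N w, name N e) \in known N v) = near N v w && (w \in e).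
Proof.
move=> eH; apply/knownP/andP => [[w' [e' [[]]]]|[nvw we]]; last by exists w, e.
by move=> /id_inj <- /name_inj nE nvw eH' we; rewrite nE.
Qed.

End Known.

(** * Enumerating triangles *)

Section Triangles.

(** Entries of [c] are drawn from [K], so [v_i] lies on [e_i] already; the third test puts it on
    [e_{i-1}]. The two tests on [own] assign a triangle to its vertex of least ID. *)
Definition tri_ok (ind : bool) (own : nat) (K : seq (nat * nat))
    (c : {ffun 'I_3 -> nat * nat}) : bool :=
  [&& injectiveb (fun i => (c i).1), injectiveb (fun i => (c i).2),
      [forall i, ((c i).1, (c (i - 1)%R).2) \in K],
      [forall i, own <= (c i).1], [exists i, (c i).1 == own]
    & ind ==> [forall i, ((c i).1, (c (i + 1)%R).2) \notin K]].

Definition tri_post (ind : bool) (own : nat) (nms : seq nat)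
    (K : seq (nat * nat)) : tri_out :=
  (nms, [seq c <- codom (fun f : {ffun 'I_3 -> 'I_(size K)} =>
                           [ffun i => nth (0, 0) K (f i)])
        | tri_ok ind own K c]).

Lemma tri_postP ind own nms K c :
  c \in (tri_post ind own nms K).2 <-> (forall i, c i \in K) /\ tri_ok ind own K c.
Proof.
rewrite mem_filter; split=> [/andP[-> /codomP[f ->]]|[cK ->]] /=.
  by split=> // i; rewrite ffunE mem_nth.
have ltc i : index (c i) K < size K by rewrite index_mem.
apply/codomP; exists [ffun i => Ordinal (ltc i)].
by apply/ffunP => i; rewrite !ffunE nth_index.
Qed.

Variables (V : finType) (N : network V).

Definition tri (ind : bool) : pred (cyc3 V) :=
  if ind then induced_triangle (hyp N) else triangle (hyp N).

Definition cyc_code (t : cyc3 V) : {ffun 'I_3 -> nat * nat} :=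
  [ffun i => (id N (t i).1, name N (t i).2)].

Lemma same_cycle_refl (t : cyc3 V) : same_cycle t t.
Proof.
apply/existsP; exists 0%R; apply/orP; left; apply/eqP/ffunP => i.
by rewrite ffunE GRing.addr0.
Qed.

(** All readings of a cycle have the same vertices, so the responsible vertex does not depend on the
    reading. *)
Lemma same_cycle_vertex (t t' : cyc3 V) (i : 'I_3) :
  same_cycle t t' -> (exists j, (t' j).1 = (t i).1) /\ (exists j, (t' i).1 = (t j).1).
Proof.
case/existsP => k /orP[] /eqP->; split.
- by exists (i - k)%R; rewrite ffunE GRing.subrK.
- by exists (i + k)%R; rewrite ffunE.
- by exists (- i - k)%R; rewrite !ffunE /= GRing.subrK GRing.opprK.
- by exists (- (i + k))%R; rewrite !ffunE.
Qed.

Lemma ord3_cases (i j : 'I_3) : [\/ j = i, j = (i + 1)%R | j = (i - 1)%R].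
Proof.
have: [|| j == i, j == (i + 1)%R | j == (i - 1)%R].
  by move: j; apply/forallP; move: i; apply/forallP; apply/forallP; case=> [[|[|[|//]]] ?];
  apply/forallP; case=> [[|[|[|//]]] ?].
by case/or3P => /eqP; [constructor 1|constructor 2|constructor 3].
Qed.

(** Any two vertices of a triangle are equal or consecutive in one direction, hence on a common
    edge. *)
Lemma triangle_near (t : cyc3 V) i j :
  triangle (hyp N) t -> near N (t i).1 (t j).1.
Proof.
case/and4P => _ _ /forallP eH /forallP vE.
have vE1 k : (t k).1 \in (t (k - 1)%R).2 by have:= vE k; rewrite inE => /andP[].
have vE0 k : (t k).1 \in (t k).2 by have:= vE k; rewrite inE => /andP[].
case: (ord3_cases i j) => ->; apply/existsP.
- by exists (t i).2; rewrite eH !vE0.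
- by exists (t i).2; rewrite eH vE0 -{2}(GRing.addrK 1%R i) vE1.
- by exists (t (i - 1)%R).2; rewrite eH vE1 vE0.
Qed.

Lemma tri_enumerated (ind : bool) (K : V -> seq (nat * nat)) :
  (forall v, K v =i known N v) ->
  enumerates_cycles N (tri ind)
    (fun v => tri_post ind (id N v) [seq name N e | e <- ports N v] (K v)).
Proof.
move=> KE; exists (name N); split=> //; first exact: name_inj.
have sound v c : c \in (tri_post ind (id N v) [seq name N e | e <- ports N v] (K v)).2 ->
    exists2 t, tri ind t & c = cyc_code t.
  case/tri_postP => cK /and5P[/injectiveP injv /injectiveP inje /forallP c1 _ /andP[_ c2]].
  (* Each entry of the code stems from a genuine incident pair; together these pairs form the
     triangle. *)
  have /fin_all_exists[f fP] (i : 'I_3) : exists p : V * {set V},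
      [/\ c i = (id N p.1, name N p.2), near N v p.1, p.2 \in edges (hyp N) & p.1 \in p.2].
    by have:= cK i; rewrite KE => /knownP[w [e H]]; exists (w, e).
  have cf i : c i = (id N (f i).1, name N (f i).2) by case: (fP i).
  have tf : triangle (hyp N) (finfun f).
    apply/and4P; split.
    - by apply/injectiveP => i j; rewrite !ffunE => E; apply: injv; rewrite !cf E.
    - by apply/injectiveP => i j; rewrite !ffunE => E; apply: inje; rewrite !cf E.
    - by apply/forallP => i; rewrite ffunE; case: (fP i).
    - apply/forallP => i; rewrite !ffunE inE; case: (fP i) => _ _ _ ->; rewrite andbT.
      have := c1 i; rewrite KE !cf mem_known => [/andP[]//|].
      by case: (fP (i - 1)%R).
  exists (finfun f); last by apply/ffunP => i; rewrite !ffunE cf.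
  rewrite /tri; case: ind c2 {cK} => //= /forallP c2; rewrite /induced_triangle tf /=.
  apply/forallP => i; have := c2 i; rewrite !ffunE KE !cf mem_known.
    by case: (fP i) => _ -> _ _ /=.
  by case: (fP (i + 1)%R).
(* Whatever reading is output, [v] is the vertex of least ID; this gives disjointness. *)
have min v c t : c \in (tri_post ind (id N v) [seq name N e | e <- ports N v] (K v)).2 ->
    denotes_cycle N (name N) c t ->
    (forall i, id N v <= id N (t i).1) /\ exists i, v = (t i).1.
  case/tri_postP => _ /and5P[_ _ _ /forallP vmin /andP[/existsP[i /eqP vi] _]].
  case/existsP => t' /andP[tt' /eqP cE]; split=> [j|].
    by have [[k <-] _] := same_cycle_vertex j tt'; have := vmin k; rewrite cE ffunE.
  have [_ [j jE]] := same_cycle_vertex i tt'; exists j; rewrite -jE.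
  by apply/esym/(@id_inj _ N); rewrite -vi cE ffunE.
split=> [v c /sound[t tP ->]|u v neq|].
- exists t; rewrite ?inE //; apply/existsP; exists t.
  by rewrite same_cycle_refl /= eqxx.
- rewrite -setI_eq0; apply/eqP/setP => t; rewrite !inE; apply/negbTE.
  apply: contra neq => /andP[/andP[_ /hasP[c cu ct]] /andP[_ /hasP[d dv dt]]].
  have [minu [i ui]] := min _ _ _ cu ct; have [minv [j vj]] := min _ _ _ dv dt.
  by apply/eqP/(@id_inj _ N)/eqP; rewrite eqn_leq {1}vj minu ui minv.
apply/setP => t; apply/bigcupP/idP => [[v _]|]; first by rewrite inE => /andP[].
rewrite inE => tP.
have tt : triangle (hyp N) t by move: tP; rewrite /tri; case: ind {sound min} => // /andP[].
have [i _ mini] := @arg_minnP _ (0%R : 'I_3) xpredT (fun i => id N (t i).1) isT.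
exists (t i).1 => //; rewrite !inE tP andTb.
have /and4P[/injectiveP injv /injectiveP inje /forallP eH /forallP vE] := tt.
apply/hasP; exists (cyc_code t); last first.
  by apply/existsP; exists t; rewrite same_cycle_refl eqxx.
apply/tri_postP; split=> [j|].
  by rewrite ffunE KE mem_known // triangle_near //; have := vE j; rewrite inE => /andP[].
apply/and5P; split.
- by apply/injectiveP => j k; rewrite !ffunE => /id_inj /injv.
- apply/injectiveP => j k; rewrite !ffunE => /name_inj nE; apply: inje; exact: nE.
- apply/forallP => j; rewrite !ffunE KE mem_known // triangle_near //.
  by have := vE j; rewrite inE => /andP[].
- by apply/forallP => j; rewrite ffunE mini.
apply/andP; split; first by apply/existsP; exists i; rewrite ffunE.
move: tP; rewrite /tri; case: ind {sound min} => //= /andP[_ /forallP nE].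
by apply/forallP => j; rewrite !ffunE KE mem_known // negb_and nE orbT.
Qed.

End Triangles.

(** * Enumerating simplices *)

Section Simplices.

Definition simplex_ok (r own : nat) (K : seq (nat * nat)) (c : seq nat) : bool :=
  [&& size c == r.+1, own \in c, all (leq own) c
    & all (fun x => has (fun p => all (fun y => (y == x) || ((y, p.2) \in K)) c) K) c].

(** The candidates are the sublists of the known IDs, one for each bit mask. *)
Definition simplex_post (r own : nat) (_ : seq nat) (K : seq (nat * nat)) :
    seq (seq nat) :=
  let X := undup (unzip1 K) in
  [seq c <- [seq mask (val m) X | m : (size X).-tuple bool] | simplex_ok r own K c].

Lemma filter_simplex_post r own nms K (p : pred nat) :
  let c := [seq x <- undup (unzip1 K) | p x] in
  simplex_ok r own K c -> c \in simplex_post r own nms K.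
Proof.
move=> c cok; rewrite mem_filter cok.
apply/mapP; exists (map_tuple p (in_tuple (undup (unzip1 K)))); first by rewrite mem_enum.
by rewrite /= /c filter_mask.
Qed.

Lemma simplex_postP r own nms K c : c \in simplex_post r own nms K ->
  [/\ simplex_ok r own K c, uniq c & {subset c <= unzip1 K}].
Proof.
rewrite mem_filter => /andP[-> /mapP[m _ ->]]; split=> //.
  by rewrite mask_uniq ?undup_uniq.
by move=> x /mem_mask; rewrite mem_undup.
Qed.

Variables (V : finType) (N : network V).

Lemma card_rank e : e \in edges (hyp N) -> #|e| <= rank (hyp N).
Proof. by move=> eH; apply: (@leq_bigmax_cond _ _ (fun e : {set V} => #|e|)). Qed.

Lemma edge_of_superset (e f : {set V}) :
  e \in edges (hyp N) -> f \subset e -> #|f| = rank (hyp N) -> f \in edges (hyp N).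
Proof.
move=> eH fe fr; suff -> : f = e by [].
by apply/eqP; rewrite eqEcard fe fr card_rank.
Qed.

Lemma denotes_mem (c : seq nat) (S : {set V}) u :
  denotes_set N c S -> (id N u \in c) = (u \in S).
Proof. by move=> /perm_mem->; rewrite mem_map ?mem_enum //; apply: id_inj. Qed.

Lemma denotesP (c : seq nat) (S : {set V}) : uniq c ->
  (forall u, (id N u \in c) = (u \in S)) ->
  (forall x, x \in c -> exists u, x = id N u) -> denotes_set N c S.
Proof.
move=> uc cS cid; apply: uniq_perm => // [|x].
  by rewrite map_inj_uniq ?enum_uniq //; apply: id_inj.
apply/idP/mapP => [xc|[u]].
  by have [u xE] := cid x xc; exists u; rewrite // mem_enum -cS -xE.
by rewrite mem_enum -cS => uc' ->.
Qed.

Lemma simplex_edge (S : {set V}) z : simplex (hyp N) S -> z \in S ->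
  S :\ z \in edges (hyp N).
Proof.
case/andP => /eqP cS /forallP fE zS; have /implyP := fE (S :\ z); apply.
by rewrite subD1set /=; have := cardsD1 z S; rewrite zS cS add1n => -[<-].
Qed.

(** Rank 0 would make the empty set an edge, so the rank is at least 2 and there is a third vertex
    [z]; the edge [S :\ z] contains both [u] and [w]. In rank 1 the two vertices of a simplex share
    no edge and cannot communicate. *)
Lemma simplex_near (S : {set V}) u w : rank (hyp N) <> 1 ->
  simplex (hyp N) S -> u \in S -> w \in S -> near N u w.
Proof.
move=> r1 sS uS wS; have /andP[/eqP cS _] := sS.
have r0 : rank (hyp N) != 0.
  apply/eqP => r0; have := simplex_edge sS uS.
  have -> : S :\ u = set0.
    by apply/eqP; rewrite -cards_eq0; have := cardsD1 u S; rewrite uS cS r0 add1n => -[<-].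
  by rewrite (negPf (edges_nonempty _)).
have /subsetPn[z zS] : ~~ (S \subset [set u; w]).
  apply: contraL (leqnn #|S|) => /subset_leq_card le; rewrite -ltnNge {2}cS.
  by apply: leq_ltn_trans le _; rewrite cards2; case: (u != w); lia.
rewrite !inE negb_or => /andP[zu zw]; apply/existsP; exists (S :\ z).
by rewrite simplex_edge // !inE uS wS ![_ == z]eq_sym zu zw.
Qed.

Lemma simplices_enumerated (K : V -> seq (nat * nat)) : rank (hyp N) <> 1 ->
  (forall v, K v =i known N v) ->
  enumerates_simplices N (fun v => simplex_post (rank (hyp N)) (id N v)
    [seq name N e | e <- ports N v] (K v)).
Proof.
move=> r1 KE.
have min v c S : c \in simplex_post (rank (hyp N)) (id N v)
    [seq name N e | e <- ports N v] (K v) -> denotes_set N c S ->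
    v \in S /\ {in S, forall u, id N v <= id N u}.
  case/simplex_postP => /and4P[_ vc /allP minv _] _ _ cS.
  by split=> [|u]; rewrite -(denotes_mem _ cS) //; apply: minv.
split=> [v c /simplex_postP[/and4P[/eqP sc _ _ /allP cok] uc cK]|u v neq|].
- have cS : denotes_set N c [set w | id N w \in c].
    apply: denotesP => // [w|x /cK /mapP[p]]; first by rewrite inE.
    by rewrite KE => /knownP[w [e [-> _ _ _]]] ->; exists w.
  exists [set w | id N w \in c] => //; move: (finset _) cS => S cS.
  have sS : #|S| = (rank (hyp N)).+1.
    by rewrite -sc (perm_size cS) size_map -cardE.
  rewrite inE /simplex sS eqxx; apply/forallP => f.
  apply/implyP => /andP[fS /eqP cf].
  (* The edge found for a vertex [z] outside [f] contains all other vertices of [S], hence [f];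
     having at most [rank] elements, it equals [f]. *)
  have /card_gt0P[z] : 0 < #|S :\: f|.
    by rewrite cardsD (setIidPr fS) sS cf subSnn.
  rewrite inE => /andP[zf zS].
  have {}/hasP[p pK /allP pall] := cok (id N z) (etrans (denotes_mem _ cS) zS).
  move: pK pall; rewrite KE => /knownP[w [e [-> _ eH _]]] /= pall.
  apply: (edge_of_superset eH _ cf); apply/subsetP => y yf.
  have := pall (id N y); rewrite (denotes_mem _ cS) (subsetP fS) // => /(_ isT).
  case/orP => [/eqP/id_inj yz|]; first by rewrite -yz yf in zf.
  by rewrite KE mem_known // => /andP[].
- rewrite -setI_eq0; apply/eqP/setP => S; rewrite !inE; apply/negbTE.
  apply: contra neq => /andP[/andP[_ /hasP[c cu cS]] /andP[_ /hasP[d dv dS]]].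
  have [uS minu] := min _ _ _ cu cS; have [vS minv] := min _ _ _ dv dS.
  by apply/eqP/(@id_inj _ N)/eqP; rewrite eqn_leq minu ?minv.
apply/setP => S; apply/bigcupP/idP => [[v _]|]; first by rewrite inE => /andP[].
rewrite inE => sS; have /andP[/eqP cS _] := sS.
have /card_gt0P[v0 v0S] : 0 < #|S| by rewrite cS.
have [u uS minu] := @arg_minnP _ v0 (mem S) (id N) v0S.
exists u => //; rewrite !inE sS andTb.
have nearS w : w \in S -> near N u w by apply: simplex_near.
have edgeK z w : z \in S -> w \in S -> w != z -> (id N w, name N (S :\ z)) \in K u.
  move=> zS wS wz; rewrite KE mem_known ?simplex_edge // nearS //.
  by rewrite !inE wz.
have other z : z \in S -> exists2 w, w \in S & w != z.
  move=> zS; have: 0 < #|S :\ z|.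
    rewrite card_gt0; apply: contraTneq (simplex_edge sS zS) => ->.
    exact: edges_nonempty.
  by case/card_gt0P => w; rewrite !inE => /andP[]; exists w.
(* The vertices of [S] are listed in the order of the known IDs, so that the list arises from a
   mask. *)
pose c := [seq x <- undup (unzip1 (K u)) | x \in [seq id N w | w <- enum S]].
have mem_c x : (x \in c) = (x \in [seq id N w | w <- enum S]).
  rewrite mem_filter mem_undup andb_idr // => /mapP[w]; rewrite mem_enum => wS ->.
  have [z zS zw] := other w wS.
  by apply/mapP; exists (id N w, name N (S :\ z)); rewrite // edgeK // eq_sym.
have denc : denotes_set N c S.
  apply: uniq_perm => //; first by rewrite filter_uniq ?undup_uniq.
  by rewrite map_inj_uniq ?enum_uniq //; apply: id_inj.
apply/hasP; exists c => //; apply: filter_simplex_post; rewrite -/c; apply/and4P; split.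
- by rewrite (perm_size denc) size_map -cardE cS.
- by rewrite (denotes_mem _ denc).
- by apply/allP => x; rewrite mem_c => /mapP[w]; rewrite mem_enum => wS ->; apply: minu.
apply/allP => x; rewrite mem_c => /mapP[z]; rewrite mem_enum => zS ->.
have [w wS wz] := other z zS.
apply/hasP; exists (id N w, name N (S :\ z)); first exact: edgeK.
apply/allP => y; rewrite mem_c => /mapP[w']; rewrite mem_enum => w'S ->.
by case: (eqVneq w' z) => [->|neq]; rewrite ?eqxx //= edgeK ?orbT.
Qed.

End Simplices.

Theorem theorem37 (B : nat -> nat) (hB : theta_log B) (c : nat) (M : model) :
  [/\ exists (A : forall n : nat, algorithm M ((B n).-tuple bool) tri_out)
             (C : nat),
        forall (V : finType) (N : network V), short_ids c N ->
          exists o : V -> tri_out,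
            halts_within N (A #|V|) (C * maxdeg (hyp N)) o /\
            enumerates_triangles N o,
      exists (A : forall n : nat, algorithm M ((B n).-tuple bool) tri_out)
             (C : nat),
        forall (V : finType) (N : network V), short_ids c N ->
          exists o : V -> tri_out,
            halts_within N (A #|V|) (C * maxdeg (hyp N)) o /\
            enumerates_induced_triangles N o
    & exists (A : forall n r : nat,
                    algorithm M ((B n).-tuple bool) (seq (seq nat)))
             (C : nat),
        forall (V : finType) (N : network V), short_ids c N ->
          rank (hyp N) <> 1 ->
          exists o : V -> seq (seq nat),
            halts_within N (A #|V| (rank (hyp N))) (C * maxdeg (hyp N)) o /\
            enumerates_simplices N o].
Proof.
have [W [C gatherC]] := gather hB c M.
pose A out post n := @protocol _ [tuple of nseq (B n) false] W out post M.
split.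
- exists (A _ (tri_post false)), C => V N /gatherC-/(_ _ (tri_post false))[K [KE halts]].
  by eexists; split; [exact: halts | exact: (tri_enumerated false)].
- exists (A _ (tri_post true)), C => V N /gatherC-/(_ _ (tri_post true))[K [KE halts]].
  by eexists; split; [exact: halts | exact: (tri_enumerated true)].
(* The rank enters only through the final local computation, so [C] is independent of it. *)
exists (fun n r => A _ (simplex_post r) n), C => V N short r1.
have [K [KE halts]] := gatherC V N short _ (simplex_post (rank (hyp N))).
by eexists; split; [exact: halts | exact: simplices_enumerated].
Qed.
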